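(* Let $\Sigma,\Delta$ be finite alphabets. If $S$ is a set of immersions from $F(\Sigma)$ to $F(\Delta)$, then $\operatorname{rk}(\operatorname{Eq}(S))\leq|\Sigma|$.
   Context: $F(\Sigma)$ is the free group on $\Sigma$, viewed as the set of freely reduced words over $\Sigma\cup\Sigma^{-1}$. A group morphism $f:F(\Sigma)\to F(\Delta)$ is an immersion if for every $x\in\Sigma\cup\Sigma^{-1}$ the freely reduced word $f(x)$ is non-empty and, for distinct $x,y\in\Sigma\cup\Sigma^{-1}$, the freely reduced words $f(x)$ and $f(y)$ start with different letters of $\Delta\cup\Delta^{-1}$. For morphisms $g,h:F(\Sigma)\to F(\Delta)$ put $\operatorname{Eq}(g,h)=\{x\in F(\Sigma)\mid g(x)=h(x)\}$, and for a set $S$ of morphisms put $\operatorname{Eq}(S)=\bigcap_{g,h\in S}\operatorname{Eq}(g,h)$, a subgroup of $F(\Sigma)$. The rank $\operatorname{rk}(H)$ of a subgroup $H$ is its minimum number of generators. *)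

(* Defs.v *)
From HB Require Import structures.
From mathcomp Require Import all_boot.
From mathcomp Require Import boolp classical_sets.

Set Implicit Arguments.
Unset Strict Implicit.
Unset Printing Implicit Defensive.

Local Open Scope classical_set_scope.
Local Open Scope group_scope.

Section FreeGroup.
Variable T : finType.

(* (a, false) is the generator a, and (a, true) is its formal inverse. *)
Definition letter : Type := T * bool.

Definition linv (x : letter) : letter := (x.1, ~~ x.2).

Definition reduced (w : seq letter) : bool :=
  sorted (fun x y => y != linv x) w.

Record freegroup := FreeGroup { fgword : seq letter; _ : reduced fgword }.
HB.instance Definition _ := [isSub for fgword].
HB.instance Definition _ := [Choice of freegroup by <:].

Definition push (x : letter) (w : seq letter) : seq letter :=
  if w is y :: w' then if y == linv x then w' else x :: w else [:: x].

Definition reduce (w : seq letter) : seq letter := foldr push [::] w.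

Definition word_inv (w : seq letter) : seq letter := rev (map linv w).

Lemma linvK : involutive linv.
Proof. by case=> a b; rewrite /linv /= negbK. Qed.

Lemma linv_neq x : linv x != x.
Proof. by case: x => a b; rewrite /linv xpair_eqE eqxx; case: b. Qed.

Lemma push_reduced x w : reduced w -> reduced (push x w).
Proof.
case: w => [|y w] //=; case: eqP => [_|/eqP nyx] /= yw; first exact: path_sorted yw.
by rewrite nyx.
Qed.

Lemma foldr_push_reduced u w : reduced w -> reduced (foldr push w u).
Proof. by move=> rw; elim: u => //= x u; apply: push_reduced. Qed.

Lemma reduce_reduced w : reduced (reduce w).
Proof. exact: foldr_push_reduced. Qed.

Lemma pushK x w : reduced w -> push x (push (linv x) w) = w.
Proof.
case: w => [|y w] /=; first by rewrite eqxx.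
rewrite linvK; case: eqP => [->|_] /=; last by rewrite eqxx.
by case: w => [|z w] //= /andP[/negPf ->].
Qed.

Lemma reduce_id w : reduced w -> reduce w = w.
Proof.
elim: w => //= x w IHw xw; rewrite IHw; last exact: path_sorted xw.
by case: w xw {IHw} => //= y w /andP[/negPf ->].
Qed.

Lemma foldr_push_push x u w :
  reduced w -> foldr push w (push x u) = push x (foldr push w u).
Proof.
case: u => [|y u] //= rw; case: eqP => [->|_] //=.
by rewrite pushK // foldr_push_reduced.
Qed.

Lemma foldr_push_reduce u w :
  reduced w -> foldr push w (reduce u) = foldr push w u.
Proof.
by move=> rw; elim: u => //= x u IHu; rewrite foldr_push_push ?IHu.
Qed.

Lemma reduce_catl u v : reduce (reduce u ++ v) = reduce (u ++ v).
Proof.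
by rewrite /reduce !foldr_cat -/(reduce u) foldr_push_reduce ?reduce_reduced.
Qed.

Lemma reduce_catr u v : reduce (u ++ reduce v) = reduce (u ++ v).
Proof.
by rewrite {1 3}/reduce !foldr_cat -/(reduce v) -/(reduce (reduce v))
     reduce_id ?reduce_reduced.
Qed.

Lemma word_inv_reduced w : reduced w -> reduced (word_inv w).
Proof.
rewrite /reduced /word_inv rev_sorted sorted_map; apply: sub_sorted => x y /=.
by rewrite linvK eq_sym.
Qed.

Lemma word_invK : involutive word_inv.
Proof. by move=> w; rewrite /word_inv map_rev revK (mapK linvK). Qed.

Lemma reduce_invr w : reduce (w ++ word_inv w) = [::].
Proof.
elim/last_ind: w => [|w x IHw] //.
rewrite /word_inv map_rcons rev_rcons cat_rcons -IHw /reduce !foldr_cat /=.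
by rewrite pushK // reduce_reduced.
Qed.

Definition fg_one : freegroup := @FreeGroup [::] isT.
Definition fg_mul (u v : freegroup) : freegroup :=
  FreeGroup (reduce_reduced (val u ++ val v)).
Definition fg_inv (u : freegroup) : freegroup :=
  FreeGroup (word_inv_reduced (valP u)).

Lemma fg_mulA : associative fg_mul.
Proof.
by move=> u v w; apply: val_inj; rewrite /= reduce_catl reduce_catr catA.
Qed.

Lemma fg_1mul : left_id fg_one fg_mul.
Proof. by move=> u; apply: val_inj; rewrite /= reduce_id // (valP u). Qed.

Lemma fg_mul1 : right_id fg_one fg_mul.
Proof.
by move=> u; apply: val_inj; rewrite /= cats0 reduce_id // (valP u).
Qed.

Lemma fg_mulV : right_inverse fg_one fg_inv fg_mul.
Proof. by move=> u; apply: val_inj; rewrite /= reduce_invr. Qed.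

Lemma fg_Vmul : left_inverse fg_one fg_inv fg_mul.
Proof.
move=> u; apply: val_inj.
by rewrite /= -[X in _ ++ X]word_invK reduce_invr.
Qed.

HB.instance Definition _ :=
  isGroup.Build freegroup fg_mulA fg_1mul fg_mul1 fg_Vmul fg_mulV.

Definition fgletter (x : letter) : freegroup := @FreeGroup [:: x] isT.

End FreeGroup.

Notation group_hom G H := (UMagmaMorphism.type G H).

Definition immersion (Sigma Delta : finType)
    (f : group_hom (freegroup Sigma) (freegroup Delta)) : Prop :=
  (forall x : letter Sigma, fgword (f (fgletter x)) <> [::]) /\
  (forall x y : letter Sigma, x <> y ->
     ohead (fgword (f (fgletter x))) <> ohead (fgword (f (fgletter y)))).

Section Equalizer.
Variables G H : groupType.

Definition equalizer (g h : group_hom G H) : set G := [set x | g x = h x].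

(* For S = set0 the intersection is the whole group. *)
Definition Eq (S : set (group_hom G H)) : set G :=
  \bigcap_(g in S) \bigcap_(h in S) equalizer g h.

End Equalizer.

Section Rank.
Variable G : groupType.

Definition is_subgroup (H : set G) : Prop := group_closed (mem H).

Definition generated (A : set G) : set G := smallest is_subgroup A.

Definition generated_by (H : set G) (n : nat) : Prop :=
  exists t : n.-tuple G, generated [set` t] = H.

(* Stated as a relation, since it has no value when H is not finitely
   generated. *)
Definition has_rank (H : set G) (r : nat) : Prop :=
  generated_by H r /\ forall n, generated_by H n -> (r <= n)%N.

End Rank.

Lemma is_subgroup_Eq (G H : groupType) (S : set (group_hom G H)) :
  is_subgroup (Eq S).
Proof.
split=> [|x y]; rewrite !inE.
  by move=> g _ h _; rewrite /equalizer /= !gmulf1.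
move=> Sx Sy g Sg h Sh; rewrite /equalizer /= !gmulfF.
by rewrite (Sx g Sg h Sh) (Sy g Sg h Sh).
Qed.

(* Main.v *)
Require Import Defs.
From mathcomp Require Import all_boot.
From mathcomp Require Import boolp.
From mathcomp Require Import classical_sets.

(** Once the first letter of an element of the equalizer is known, the letters
that follow are forced up to the next prefix lying in the equalizer.  So the
equalizer is generated by one element for each possible first letter, and
these generators are paired off by inversion.

An immersion never cancels: on a reduced word it acts by concatenating the
words of the letters ([immersion_word]).  Moreover those words start with
distinct letters, so one letter of the image is enough to decode the next
letter of the argument.  Suppose that g and h agree on two words which branch
after a common prefix p, that is, which continue with distinct letters.  If
g p and h p had different lengths, the longer one would sit in the image of
both words, and the overlap would decode to the letter following p, which
would then be the same in both words.  So g p and h p have the same length,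
and they are prefixes of the same word: g and h agree on p.  Hence Eq S
contains the branching prefix of any two of its elements
([branch_closed_Eq]).

A subgroup H closed in this sense has rank at most the number of generators
([branch_closed_rank]).  Among the nontrivial elements of H starting with a
given letter x there is one, the block of x, which is a prefix of all the
others ([first_block_exists]).  Peeling off blocks from the left shows that
the blocks generate H.  The inverse of a block is again a block
([first_block_inv]), and it is a different one since no nontrivial reduced
word is its own inverse ([word_inv_fix]).  So the blocks, of which there are
at most twice as many as generators, come in pairs of mutually inverse
elements, and one element of each pair suffices. *)

Set Implicit Arguments.
Unset Strict Implicit.
Unset Printing Implicit Defensive.

Local Open Scope group_scope.

(** * Words *)

Lemma prefix_or_branch (A : eqType) (u v : seq A) :
  [\/ prefix u v, prefix v u |
      exists p x y s t, [/\ u = p ++ x :: s, v = p ++ y :: t & x != y]].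
Proof.
elim: u v => [|x u IHu] [|y v]; try by [apply: Or31 | apply: Or32].
have [<-|neq_xy] := eqVneq x y; last first.
  by apply: Or33; exists [::], x, y, u, v.
case: (IHu v) => [uv|vu|[p [a [b [s [t [-> -> neq_ab]]]]]]].
- by apply: Or31; rewrite prefix_cons eqxx.
- by apply: Or32; rewrite prefix_cons eqxx.
- by apply: Or33; exists (x :: p), a, b, s, t.
Qed.

Lemma prefix_anti (A : eqType) (u v : seq A) : prefix u v -> prefix v u -> u = v.
Proof.
move=> uv /size_prefix le_vu.
by move: uv; rewrite prefixE take_oversize // => /eqP->.
Qed.

Lemma ohead_cat (A : Type) (u v : seq A) :
  u <> [::] -> ohead (u ++ v) = ohead u.
Proof. by case: u. Qed.

Section Words.
Variable T : finType.
Implicit Types (x y : letter T) (u v : seq (letter T)) (w : freegroup T).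

Lemma fgwordM w1 w2 : fgword (w1 * w2) = reduce (fgword w1 ++ fgword w2).
Proof. by []. Qed.

Lemma fgwordV w : fgword w^-1 = word_inv (fgword w).
Proof. by []. Qed.

Lemma word_inv_cat u v : word_inv (u ++ v) = word_inv v ++ word_inv u.
Proof. by rewrite /word_inv map_cat rev_cat. Qed.

Lemma size_word_inv u : size (word_inv u) = size u.
Proof. by rewrite size_rev size_map. Qed.

Lemma reduce_invl u : reduce (word_inv u ++ u) = [::].
Proof. by rewrite -{2}[u]word_invK reduce_invr. Qed.

Lemma reduced_cat u v : reduced u -> reduced v ->
  (forall y, ohead v = Some y -> ohead (word_inv u) <> Some y) ->
  reduced (u ++ v).
Proof.
case: v => [|y v]; first by rewrite cats0.
case/lastP: u => [|u a] //= ru rv /(_ y erefl) neq_ya.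
rewrite /reduced cat_rcons sorted_cat_cons -/(reduced _) ru /= rv andbT.
apply: contra_notN neq_ya => /eqP->.
by rewrite /word_inv map_rcons rev_rcons.
Qed.

(** Cutting such a word in the middle, either the two halves are inverse to
each other and the word is not reduced, or a letter is left over in the middle
which is its own inverse. *)
Lemma word_inv_fix u : reduced u -> word_inv u = u -> u = [::].
Proof.
move=> ru; set s := take (size u)./2 u; set t := drop (size u)./2 u.
have def_u : s ++ t = u by exact: cat_take_drop.
have size_s : size s = (size u)./2.
  by rewrite size_takel // -{2}[size u]odd_double_half -addnn addnCA leq_addr.
have size_t : size t = odd (size u) + size s.
  have := congr1 size def_u; rewrite size_cat size_s -{2}[size u]odd_double_half.
  by rewrite -addnn addnCA => /addnI.
rewrite -{1}def_u word_inv_cat -{1}def_u.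
case: (odd _) size_t => [|/=]; rewrite ?add0n ?add1n => size_t eq_u.
  case: t size_t def_u eq_u => // c t [size_t] def_u.
  rewrite -cat1s word_inv_cat -catA => /eqP.
  rewrite eqseq_cat ?size_word_inv // => /andP[_ /eqP[/eqP]].
  by rewrite (negPf (linv_neq c)).
move/eqP: eq_u; rewrite eqseq_cat ?size_word_inv // => /andP[/eqP def_s _].
by have := reduce_invl t; rewrite def_s def_u reduce_id.
Qed.

End Words.

(** * Equalizers of immersions *)

(** The words in such a set span a tree in the Cayley graph, and its branching
points lie in the set: an element of the set is determined, up to its next
prefix in the set, by a single letter. *)
Definition branch_closed (T : finType) (H : set (freegroup T)) : Prop :=
  forall (w1 w2 p : freegroup T) x y s t, H w1 -> H w2 ->
    fgword w1 = fgword p ++ x :: s -> fgword w2 = fgword p ++ y :: t ->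
    x != y -> H p.

Section Immersions.
Variables Sigma Delta : finType.
Implicit Types f g h : group_hom (freegroup Sigma) (freegroup Delta).

(** There is no cancellation between the words of consecutive letters x and y
of a reduced word: the inverse of the word of x is the word of the letter
inverse to x, which differs from y, so the two start differently. *)
Lemma immersion_word f (w : freegroup Sigma) : immersion f ->
  fgword (f w) = flatten [seq fgword (f (fgletter x)) | x <- fgword w].
Proof.
case=> f_neq0 f_inj; case: w => w; elim: w => [|x w IHw] rxw.
  by rewrite (_ : FreeGroup rxw = 1) ?gmulf1 //; apply: val_inj.
have rw : reduced w by exact: path_sorted rxw.
have def_f : f (FreeGroup rxw) = f (fgletter x) * f (FreeGroup rw).
  rewrite -gmulfM; congr (f _); apply: val_inj.
  exact: esym (reduce_id rxw).
have /= {}IHw := IHw rw.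
rewrite def_f fgwordM /= -IHw reduce_id //.
apply: reduced_cat; try exact: (valP (f _)).
move=> y; rewrite IHw /=; case: w rxw rw {def_f IHw} => //= z w /andP[neq_zx _] _.
rewrite (ohead_cat _ (f_neq0 z)) => <-; rewrite -fgwordV -gmulfV.
have -> : (fgletter x)^-1 = fgletter (linv x) by exact: val_inj.
by apply: f_inj => eq_zx; rewrite eq_zx eqxx in neq_zx.
Qed.

Lemma immersion_word_cat f (w p : freegroup Sigma) x s : immersion f ->
  fgword w = fgword p ++ x :: s ->
  exists t, fgword (f w) = fgword (f p) ++ fgword (f (fgletter x)) ++ t.
Proof.
move=> fI def_w; rewrite !immersion_word // def_w map_cat flatten_cat /=.
by rewrite cats0; eexists.
Qed.

(** If h p were longer than g p, then the letter of h p at position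
[size (g p)] would be the first letter of both g x and g y. *)
Lemma immersion_branch_size g h (w1 w2 p : freegroup Sigma) x y s t :
    immersion g -> immersion h -> g w1 = h w1 -> g w2 = h w2 ->
    fgword w1 = fgword p ++ x :: s -> fgword w2 = fgword p ++ y :: t ->
    x != y ->
  size (fgword (h p)) <= size (fgword (g p)).
Proof.
move=> gI hI gh1 gh2 def1 def2 neq_xy; rewrite leqNgt; apply/negP=> lt_gh.
have next w z r : g w = h w -> fgword w = fgword p ++ z :: r ->
    ohead (fgword (g (fgletter z)))
      = ohead (drop (size (fgword (g p))) (fgword (h p))).
  move=> gh_w def_w; have [r1 def_g] := immersion_word_cat gI def_w.
  have [r2 def_h] := immersion_word_cat hI def_w.
  have := congr1 (ohead \o drop (size (fgword (g p)))) def_g.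
  rewrite gh_w def_h /= drop_cat lt_gh drop_size_cat // !ohead_cat //.
    exact: (proj1 gI).
  by move/(congr1 size)/eqP; rewrite size_drop subn_eq0 leqNgt lt_gh.
apply: (proj2 gI x y); first exact/eqP.
by rewrite (next _ _ _ gh1 def1) (next _ _ _ gh2 def2).
Qed.

Lemma branch_closed_equalizer g h :
  immersion g -> immersion h -> branch_closed (equalizer g h).
Proof.
move=> gI hI w1 w2 p x y s t gh1 gh2 def1 def2 neq_xy.
have size_gh : size (fgword (g p)) = size (fgword (h p)).
  apply/eqP; rewrite eqn_leq.
  by rewrite (immersion_branch_size gI hI gh1 gh2 def1 def2 neq_xy)
     (immersion_branch_size hI gI (esym gh1) (esym gh2) def1 def2 neq_xy).
have [r1 def_g] := immersion_word_cat gI def1.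
have [r2 def_h] := immersion_word_cat hI def1.
apply/val_inj/eqP => /=.
move/eqP: def_h; rewrite -gh1 def_g eqseq_cat //.
by case/andP.
Qed.

Lemma branch_closed_Eq (S : set (group_hom (freegroup Sigma) (freegroup Delta))) :
  (forall f, S f -> immersion f) -> branch_closed (Eq S).
Proof.
move=> SI w1 w2 p x y s t E1 E2 def1 def2 neq_xy g Sg h Sh.
exact: (branch_closed_equalizer (SI g Sg) (SI h Sh) (E1 g Sg h Sh)
  (E2 g Sg h Sh) def1 def2 neq_xy).
Qed.

End Immersions.

(** * Blocks *)

Section Blocks.
Variables (T : finType) (H : set (freegroup T)).
Implicit Types (x y : letter T) (w b : freegroup T).

(** Minimality is for the prefix order and not only for length, so that a block
can be split off from every element of H starting with its letter. *)
Definition first_block x b : Prop :=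
  [/\ H b, ohead (fgword b) = Some x &
      forall w, H w -> ohead (fgword w) = Some x ->
        prefix (fgword b) (fgword w)].

Lemma first_block_uniq x b1 b2 :
  first_block x b1 -> first_block x b2 -> b1 = b2.
Proof.
move=> [Hb1 hd1 min1] [Hb2 hd2 min2]; apply: val_inj.
by apply: prefix_anti; [apply: min1 | apply: min2].
Qed.

Hypothesis H_branch : branch_closed H.

(** A shortest candidate works: if it branched off from another element, then
the common prefix would be a shorter candidate. *)
Lemma first_block_exists w x :
  H w -> ohead (fgword w) = Some x -> exists b, first_block x b.
Proof.
move=> Hw hd_w.
pose P n := `[< exists b, [/\ H b, ohead (fgword b) = Some x
                          & size (fgword b) = n] >].
have exP : exists n, P n by exists (size (fgword w)); apply/asboolP; exists w.
case: (ex_minnP exP) => n /asboolP[b [Hb hd_b size_b]] min_n.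
exists b; split=> // v Hv hd_v.
have le_b u : H u -> ohead (fgword u) = Some x ->
    size (fgword b) <= size (fgword u).
  by move=> Hu hd_u; rewrite size_b; apply: min_n; apply/asboolP; exists u.
case: (prefix_or_branch (fgword b) (fgword v)) => //.
  move=> vb; move: (vb); rewrite prefixE take_oversize ?le_b // => /eqP->.
  exact: prefix_refl.
case=> p [y [z [s [t [def_b def_v neq_yz]]]]].
have rp : reduced p.
  by move: (valP b); rewrite [val b]def_b => /cat_sorted2[].
have Hp : H (FreeGroup rp) by exact: (@H_branch b v (FreeGroup rp) y z s t).
(* The words of b and v both start with x, so they cannot branch at once. *)
case: p => [|a p] in def_b def_v rp Hp *.
  case/eqP: neq_yz; move: hd_b hd_v.
  by rewrite def_b def_v /= => -[->] [->].
have := le_b _ Hp; rewrite -hd_b def_b /= => /(_ erefl).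
by rewrite size_cat /= addnS ltnS ltnNge leq_addr.
Qed.

Hypothesis H_group : is_subgroup H.

Lemma subgroupV w : H w -> H w^-1.
Proof. by have := group_closedV H_group (x := w); rewrite !inE. Qed.

Lemma subgroupM w1 w2 : H w1 -> H w2 -> H (w1 * w2).
Proof. by have := group_closedM H_group (x := w1) (y := w2); rewrite !inE. Qed.

(** The inverse of b starts with a block c.  Removing from b the end that c
cancels leaves a prefix of b in H, which is trivial by minimality of b; so c
is the whole inverse.  It cannot start with the same letter as b, since then
it would be b itself, and only the empty word is its own inverse. *)
Lemma first_block_inv x b :
  first_block x b -> exists2 y, y != x & first_block y b^-1.
Proof.
move=> b_block; have [Hb hd_b min_b] := b_block.
have [y hd_y] : exists y, ohead (fgword b^-1) = Some y.
  rewrite fgwordV; case def_v: (word_inv (fgword b)) => [|y v]; last by exists y.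
  by move: hd_b; rewrite -[fgword b]word_invK def_v.
have [c c_block] := first_block_exists (subgroupV Hb) hd_y.
have [Hc hd_c min_c] := c_block.
have /prefixP[d] := min_c _ (subgroupV Hb) hd_y.
rewrite fgwordV => def_V.
have def_b : fgword b = word_inv d ++ word_inv (fgword c).
  by rewrite -word_inv_cat -def_V word_invK.
have rd : reduced (word_inv d).
  by move: (valP b); rewrite [val b]def_b => /cat_sorted2[].
have def_bc : b * c = FreeGroup rd.
  apply: val_inj; rewrite [LHS]fgwordM def_b -catA -reduce_catr.
  by rewrite reduce_invl cats0 reduce_id.
have d0 : word_inv d = [::].
  case def_d: (word_inv d) => [|a e] //.
  have Hd : H (FreeGroup rd) by rewrite -def_bc; apply: subgroupM.
  have /size_prefix : prefix (fgword b) (word_inv d).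
    by apply: (min_b _ Hd); rewrite -hd_b def_b /= def_d.
  rewrite def_b def_d.
  rewrite size_cat size_word_inv -{2}[size _]addn0 leq_add2l leqn0.
  by move/nilP => c0; rewrite c0 in hd_c.
have def_c : b^-1 = c.
  apply: val_inj; rewrite [LHS]fgwordV def_V.
  by rewrite -[d]word_invK d0 cats0.
exists y; last by rewrite def_c.
apply/eqP=> eq_yx.
rewrite eq_yx -def_c in c_block.
have /(congr1 (@fgword T)) := first_block_uniq c_block b_block.
rewrite fgwordV => /(word_inv_fix (valP b)) b0.
by rewrite b0 in hd_b.
Qed.

(** Peeling the first block off an element of H leaves a shorter element of H,
because that block is a prefix of it. *)
Lemma generated_first_blocks (M : set (freegroup T)) : is_subgroup M ->
  (forall x b, first_block x b -> M b) -> forall w, H w -> M w.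
Proof.
move=> M_group Mblock w.
have [n] := ubnP (size (fgword w)); elim: n w => // n IHn w lt_wn Hw.
case def_w: (fgword w) => [|x s].
  have -> : w = 1 by exact: val_inj.
  by have [] := M_group; rewrite inE.
have hd_w : ohead (fgword w) = Some x by rewrite def_w.
have [b b_block] := first_block_exists Hw hd_w.
have [Hb hd_b /(_ w Hw hd_w)/prefixP[t def_bt]] := b_block.
have def_t : fgword (b^-1 * w) = t.
  rewrite fgwordM fgwordV def_bt catA -reduce_catl reduce_invl reduce_id //.
  by move: (valP w); rewrite [val w]def_bt => /cat_sorted2[].
rewrite -[w](mulVKg b).
have := group_closedM M_group (x := b) (y := b^-1 * w); rewrite !inE; apply.
  exact: Mblock b_block.
apply: IHn; last by apply: subgroupM => //; apply: subgroupV.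
rewrite def_t; move: lt_wn; rewrite ltnS def_bt size_cat; apply: leq_trans.
by case: (fgword b) hd_b => //= *; rewrite addSn ltnS leq_addl.
Qed.

End Blocks.

(** * The rank bound *)

(** From each pair {x, s x} keep the element that comes first in the
enumeration of U. *)
Lemma half_transversal (U : finType) (D : {set U}) (s : U -> U) :
    {in D, forall x, [/\ s x \in D, s (s x) = x & s x != x]} ->
  exists A : {set U}, [/\ A \subset D, #|A|.*2 <= #|U| &
    forall x, x \in D -> x \in A \/ s x \in A].
Proof.
move=> sP; pose A := [set x in D | enum_rank x < enum_rank (s x)]%SET.
have sAD : A \subset D by apply/fintype.subsetP=> x; rewrite inE => /andP[].
exists A; split=> //.
  have card_sA : #|(s @: A)%SET| = #|A|.
    apply: card_in_imset => x y /(fintype.subsetP sAD) /sP[_ sx _].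
    by move=> /(fintype.subsetP sAD) /sP[_ sy _] eq_s; rewrite -sx eq_s sy.
  have : [disjoint A & (s @: A)%SET].
    apply/pred0P=> x /=; apply/negP=> /andP[xA /imsetP[y yA def_x]].
    move: xA yA; rewrite def_x !inE => /andP[_ lt_s] /andP[/sP[_ sy _]].
    by rewrite sy in lt_s; rewrite ltnNge ltnW.
  rewrite -leq_card_setU => /eqP card_U.
  by rewrite -addnn -{2}card_sA -card_U max_card.
move=> x xD; have [sxD ssx neq_sx] := sP x xD.
rewrite !inE xD sxD ssx /=; case: ltngtP => [||eq_r]; [by left | by right |].
by case/eqP: neq_sx; apply/enum_rank_inj/val_inj.
Qed.

(** The blocks are indexed by their first letters, of which there are at most
[2 * #|T|], and inversion acts on them without fixed points. *)
Lemma branch_closed_rank (T : finType) (H : set (freegroup T)) :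
  is_subgroup H -> branch_closed H ->
  exists2 n, generated_by H n & n <= #|T|.
Proof.
move=> H_group H_branch.
pose b x := xget 1 (first_block H x).
pose D := [set x : letter T | `[< exists b, first_block H x b >]]%SET.
have bP x : x \in D -> first_block H x (b x).
  by rewrite inE => /asboolP[c c_block]; apply: xgetI c_block.
(* The inverse of the block of x is the block of s x. *)
pose s x := head x (fgword (b x)^-1).
have sP x : x \in D -> first_block H (s x) (b x)^-1 /\ s x != x.
  move=> /bP /(first_block_inv H_branch H_group)[y neq_yx y_block].
  suff -> : s x = y by [].
  have [_ + _] := y_block; rewrite /s.
  by case: (fgword _) => //= z v [].
have s_in x : x \in D -> s x \in D.
  by case/sP => sx_block _; rewrite inE; apply/asboolP; exists (b x)^-1.
have bs x : x \in D -> b (s x) = (b x)^-1.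
  by move=> xD; apply: first_block_uniq (bP _ (s_in _ xD)) (sP _ xD).1.
have [x xD|A [sAD leA A_half]] := @half_transversal _ D s.
  split; [exact: s_in | | by have [] := sP x xD].
  have [[_ + _] _] := sP _ (s_in x xD); have [_ + _] := bP x xD.
  by rewrite bs // invgK => -> [].
exists #|A|; last first.
  rewrite -leq_double (leq_trans leA) // card_prod card_bool.
  by rewrite muln2.
exists (map_tuple b (enum_tuple A)); apply/seteqP; split.
  apply: smallest_sub => // _ /= /mapP[x + ->].
  by rewrite mem_enum => /(fintype.subsetP sAD)/bP[].
move=> w Hw M [M_group AM]; move: w Hw.
apply: (generated_first_blocks H_branch H_group M_group) => x c c_block.
have xD : x \in D by rewrite inE; apply/asboolP; exists c.
have Mb z : z \in A -> M (b z).
  by move=> zA; apply: AM => /=; apply/map_f; rewrite mem_enum.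
rewrite (first_block_uniq c_block (bP x xD)).
case: (A_half x xD) => [|/Mb]; first exact: Mb.
rewrite bs // => MV; rewrite -[b x]invgK.
by have := group_closedV M_group (x := (b x)^-1); rewrite !inE; apply.
Qed.

Theorem corollary5 (Sigma Delta : finType)
    (S : set (group_hom (freegroup Sigma) (freegroup Delta)))
    (hS : forall f, S f -> immersion f) :
  exists r : nat, has_rank (Eq S) r /\ r <= #|Sigma|.
Proof.
have [n gen_n le_n] :=
  branch_closed_rank (is_subgroup_Eq S) (branch_closed_Eq hS).
have exP : exists m, `[< generated_by (Eq S) m >] by exists n; apply/asboolP.
case: (ex_minnP exP) => r /asboolP gen_r min_r.
exists r; split; last by apply: leq_trans le_n; apply/min_r/asboolP.
by split=> // m gen_m; apply/min_r/asboolP.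
Qed.
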